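(* Let $H$ be a Hilbert space and $T:\operatorname{Dom}(T)\to H$ a densely defined operator with closed graph. Then the orthogonal projection $P_{\mathrm{Gr}(T)}$ of $H\times H$ onto the graph $\mathrm{Gr}(T)=\{(h,Th):h\in\operatorname{Dom}(T)\}\subset H\times H$ belongs to the unitary orbit of $\begin{pmatrix} 1 & 0 \\ 0 & 0 \end{pmatrix}$, i.e. to the Riemann sphere $\mathcal{R}$ of the algebra $B(H)$. Moreover, $$P_{\mathrm{Gr}(T)}=\begin{pmatrix} 1 \\ T \end{pmatrix}(1+T^*T)^{-1}\begin{pmatrix} 1 & T^* \end{pmatrix}=\begin{pmatrix} 1 & T^* \\ T & TT^* \end{pmatrix}\begin{pmatrix} 1+T^*T & 0 \\ 0 & 1+TT^* \end{pmatrix}^{-1}$$ $$=\begin{pmatrix} (1+T^*T)^{-1} & (1+T^*T)^{-1}T^* \\ T(1+T^*T)^{-1} & T(1+T^*T)^{-1}T^* \end{pmatrix},$$ and all the entries of the last matrix are bounded operators.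
   Context: The Riemann sphere of $B(H)$ is $\mathcal{R}=\{\tilde u\tilde p_0\tilde u^*:\tilde u\text{ unitary in }M_2(B(H))=B(H\oplus H)\}$, with $\tilde p_0=\begin{pmatrix} 1 & 0 \\ 0 & 0 \end{pmatrix}$. The expressions with $T^*$ as the rightmost factor are a priori defined on the dense subspace $\operatorname{Dom}(T^* )$ and are identified with their unique bounded extensions to $H$. *)

(* Defs.v *)
From HB Require Import structures.
From mathcomp Require Import all_boot all_order all_algebra.
From mathcomp Require Import all_classical all_reals all_analysis.
From mathcomp.real_closed Require Export complex.
From mathcomp Require Import ring.
Import numFieldNormedType.Exports.

Set Implicit Arguments.
Unset Strict Implicit.
Unset Printing Implicit Defensive.
Import Order.TTheory GRing.Theory Num.Theory.
Local Open Scope classical_set_scope.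
Local Open Scope ring_scope.

(** Complex Hilbert spaces. The inner product is linear in its first argument
    and conjugate-linear in the second one; norms take their values in [R[i]]. *)

HB.mixin Record isHilbert (R : realType) H & CompleteNormedModule R[i] H := {
  inner : {dot H for Num.conj};
  inner_norm : forall x : H, inner x x = `|x| ^+ 2
}.

#[short(type="hilbertType")]
HB.structure Definition Hilbert (R : realType) :=
  {H of CompleteNormedModule R[i] H & isHilbert R H}.

(** The product type [X * Y] already carries the sup norm in the library, hence
    an alias for the Hilbert direct sum. *)

Definition hsum (R : realType) (X Y : hilbertType R) : Type := (X * Y)%type.

Section HilbertSum.
Context {R : realType} {X Y : hilbertType R}.
Implicit Types p q : hsum X Y.

HB.instance Definition _ := GRing.Lmodule.copy (hsum X Y) (X * Y)%type.

Definition hsum_inner p q : R[i] := inner p.1 q.1 + inner p.2 q.2.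

Lemma hsum_inner_bilinear :
  bilinear_for *%R (Num.conj \; *%R) hsum_inner.
Proof.
split=> [q a p p'|p a q q']; rewrite /hsum_inner /=.
  by rewrite !linearPl/= mulrDr addrACA.
by rewrite !linearPr/= mulrDr addrACA.
Qed.

HB.instance Definition _ := bilinear_isBilinear.Build R[i] (hsum X Y) (hsum X Y)
  R[i] *%R (Num.conj \; *%R) hsum_inner hsum_inner_bilinear.

Lemma hsum_inner_herm p q :
  hsum_inner p q = (-1) ^+ false * Num.conj (hsum_inner q p).
Proof.
rewrite /hsum_inner expr0 mul1r rmorphD /=.
by rewrite [inner p.1 q.1]hermC [inner p.2 q.2]hermC !expr0 !mul1r.
Qed.

HB.instance Definition _ := isHermitianSesquilinear.Build R[i] (hsum X Y) false
  Num.conj hsum_inner hsum_inner_herm.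

Lemma hsum_innerE p : hsum_inner p p = `|p.1| ^+ 2 + `|p.2| ^+ 2.
Proof. by rewrite /hsum_inner !inner_norm. Qed.

Lemma hsum_inner_gt0 p : p != 0 -> 0 < hsum_inner p p.
Proof.
move=> p0; rewrite hsum_innerE lt_neqAle addr_ge0 ?exprn_ge0// andbT eq_sym.
apply: contra p0; rewrite paddr_eq0 ?exprn_ge0// !expf_eq0/= !normr_eq0.
by case: p => a b /= /andP[/eqP-> /eqP->].
Qed.

HB.instance Definition _ :=
  isDotProduct.Build R[i] (hsum X Y) hsum_inner hsum_inner_gt0.

Definition hsum_norm p : R[i] := sqrtC (`|p.1| ^+ 2 + `|p.2| ^+ 2).

Lemma hsum_norm_sq p : hsum_norm p ^+ 2 = `|p.1| ^+ 2 + `|p.2| ^+ 2.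
Proof. exact: sqrtCK. Qed.

Lemma hsum_norm_ge0 p : 0 <= hsum_norm p.
Proof. by rewrite sqrtC_ge0 addr_ge0 ?exprn_ge0. Qed.

Lemma hsum_normD p q : hsum_norm (p + q) <= hsum_norm p + hsum_norm q.
Proof.
rewrite -(@ler_pXn2r _ 2)// ?nnegrE ?addr_ge0 ?hsum_norm_ge0//.
rewrite sqrrD !hsum_norm_sq /=.
set a := `|p.1|; set b := `|q.1|; set c := `|p.2|; set d := `|q.2|.
have [a0 b0 c0 d0] : [/\ 0 <= a, 0 <= b, 0 <= c & 0 <= d] by split; exact: normr_ge0.
have adR : a * d - c * b \is Num.real by rewrite rpredB ?rpredM ?ger0_real.
have cs : a * b + c * d <= hsum_norm p * hsum_norm q.
  rewrite -(@ler_pXn2r _ 2)// ?nnegrE ?addr_ge0 ?mulr_ge0 ?hsum_norm_ge0//.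
  rewrite exprMn !hsum_norm_sq -subr_ge0.
  suff -> : (`|p.1| ^+ 2 + `|p.2| ^+ 2) * (`|q.1| ^+ 2 + `|q.2| ^+ 2)
      - (a * b + c * d) ^+ 2 = (a * d - c * b) ^+ 2 by rewrite real_exprn_even_ge0.
  by rewrite -/a -/b -/c -/d; ring.
apply: (@le_trans _ _ ((a + b) ^+ 2 + (c + d) ^+ 2)).
  by apply: lerD; rewrite ler_pXn2r ?nnegrE ?addr_ge0 ?ler_normD.
suff -> : (a + b) ^+ 2 + (c + d) ^+ 2 =
    a ^+ 2 + c ^+ 2 + (a * b + c * d) *+ 2 + (b ^+ 2 + d ^+ 2).
  by rewrite lerD2r lerD2l lerMn2r.
ring.
Qed.

Lemma hsum_normZ (a : R[i]) p : hsum_norm (a *: p) = `|a| * hsum_norm p.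
Proof.
rewrite /hsum_norm /= !normrZ !exprMn -mulrDr rootCMl ?exprn_ge0//.
by rewrite sqrCK.
Qed.

Lemma hsum_norm_eq0 p : hsum_norm p = 0 -> p = 0.
Proof.
move=> /eqP; rewrite sqrtC_eq0 paddr_eq0 ?exprn_ge0// !expf_eq0/= !normr_eq0.
by case: p => a b /= /andP[/eqP-> /eqP->].
Qed.

HB.instance Definition _ := Lmodule_isNormed.Build R[i] (hsum X Y)
  hsum_normD hsum_normZ hsum_norm_eq0.

Lemma hsum_norm1 p : `|p.1| <= `|p|.
Proof.
rewrite -(@ler_pXn2r _ 2)// ?nnegrE// [`|p| ^+ 2]hsum_norm_sq.
by rewrite lerDl exprn_ge0.
Qed.

Lemma hsum_norm2 p : `|p.2| <= `|p|.
Proof.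
rewrite -(@ler_pXn2r _ 2)// ?nnegrE// [`|p| ^+ 2]hsum_norm_sq.
by rewrite lerDr exprn_ge0.
Qed.

Lemma hsum_norm_le p : `|p| <= `|p.1| + `|p.2|.
Proof.
rewrite -(@ler_pXn2r _ 2)// ?nnegrE ?addr_ge0// [`|p| ^+ 2]hsum_norm_sq sqrrD.
by rewrite addrAC lerDl mulrn_wge0// mulr_ge0.
Qed.

Lemma hsum_complete (F : set_system (hsum X Y)) :
  ProperFilter F -> cauchy F -> cvg F.
Proof.
move=> FF /cauchy_ballP Fc.
have c1 : cauchy ((fun p : hsum X Y => p.1) @ F).
  apply/cauchy_ballP => e e0; have := Fc e e0.
  rewrite !near_simpl => -[[A B] [FA FB] AB].
  exists ((fun p : hsum X Y => p.1) @` A, (fun p : hsum X Y => p.1) @` B).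
    by split => /=; [apply: filterS FA|apply: filterS FB] => x; exists x.
  move=> [_ _] [/= [x Ax <-] [y By <-]].
  have := AB (x, y) (conj Ax By); rewrite -!ball_normE /=.
  by apply: le_lt_trans; exact: (hsum_norm1 (x - y)).
have c2 : cauchy ((fun p : hsum X Y => p.2) @ F).
  apply/cauchy_ballP => e e0; have := Fc e e0.
  rewrite !near_simpl => -[[A B] [FA FB] AB].
  exists ((fun p : hsum X Y => p.2) @` A, (fun p : hsum X Y => p.2) @` B).
    by split => /=; [apply: filterS FA|apply: filterS FB] => x; exists x.
  move=> [_ _] [/= [x Ax <-] [y By <-]].
  have := AB (x, y) (conj Ax By); rewrite -!ball_normE /=.
  by apply: le_lt_trans; exact: (hsum_norm2 (x - y)).
have [a Fa] := (cvg_ex _).1 (cauchy_cvg _ c1).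
have [b Fb] := (cvg_ex _).1 (cauchy_cvg _ c2).
apply: (cvg_ex _).2; exists ((a, b) : hsum X Y).
apply/cvgrPdist_lt => e e0; near=> p.
apply: le_lt_trans (hsum_norm_le _) _; rewrite (splitr e); apply: ltrD => /=.
  near: p; move/cvgrPdist_lt : Fa; apply; exact: divr_gt0.
near: p; move/cvgrPdist_lt : Fb; apply; exact: divr_gt0.
Unshelve. all: by end_near. Qed.

HB.instance Definition _ := Uniform_isComplete.Build (hsum X Y) hsum_complete.

Lemma hsum_inner_norm p : hsum_inner p p = `|p| ^+ 2.
Proof. by rewrite hsum_innerE [RHS]hsum_norm_sq. Qed.

HB.instance Definition _ := isHilbert.Build R (hsum X Y) hsum_inner_norm.

End HilbertSum.

(** Partially defined maps, used for unbounded operators. The values of [app]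
    outside [dom] are irrelevant: every notion below only looks at [app] on
    [dom], and [===] is equality of domains and of values on them. *)

Record operator (R : realType) (X Y : hilbertType R) :=
  Operator { dom : set X ; app :> X -> Y }.

Declare Scope op_scope.
Delimit Scope op_scope with op.
Bind Scope op_scope with operator.

Section Operators.
Context {R : realType}.
Implicit Types X Y Z : hilbertType R.

Definition op_sub X Y (S T : operator X Y) :=
  dom S `<=` dom T /\ {in dom S, S =1 T}.

Definition op_eq X Y (S T : operator X Y) :=
  dom S = dom T /\ {in dom S, S =1 T}.

Definition linear_op X Y (T : operator X Y) :=
  dom T 0 /\
  forall (a : R[i]) x y, dom T x -> dom T y ->
    dom T (a *: x + y) /\ T (a *: x + y) = a *: T x + T y.

Definition densely_defined X Y (T : operator X Y) := dense (dom T).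

Definition graph X Y (T : operator X Y) : set (hsum X Y) :=
  [set ((h, T h) : hsum X Y) | h in dom T].

Definition closed_graph X Y (T : operator X Y) := closed (graph T).

(** Membership in [B(X, Y)]. *)
Definition bounded_op X Y (T : operator X Y) :=
  [/\ dom T = setT, linear_op T & exists M : R[i], forall x, `|T x| <= M * `|x|].

(** The operator sending [x] to the unique [y] such that [G x y], defined
    exactly at those [x] for which there is one and only one such [y]. *)
Definition op_of_rel X Y (G : X -> Y -> Prop) : operator X Y :=
  Operator [set x | exists! y, G x y] (fun x => xget 0 [set y | G x y]).

Definition op_id X : operator X X := Operator setT idfun.

Definition op_zero X Y : operator X Y := Operator setT (fun=> 0).

Definition op_add X Y (S T : operator X Y) : operator X Y :=
  Operator (dom S `&` dom T) (fun x => S x + T x).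

Definition op_mul X Y Z (S : operator Y Z) (T : operator X Y) : operator X Z :=
  Operator [set x | dom T x /\ dom S (T x)] (fun x => S (T x)).

Definition op_inv X Y (T : operator X Y) : operator Y X :=
  op_of_rel (fun y x => dom T x /\ T x = y).

Definition op_adj X Y (T : operator X Y) : operator Y X :=
  op_of_rel (fun y z => forall x, dom T x -> inner (T x) y = inner x z).

Definition op_row X Y Z (A : operator X Z) (B : operator Y Z) :
    operator (hsum X Y) Z :=
  Operator [set p : hsum X Y | dom A p.1 /\ dom B p.2]
    (fun p => A p.1 + B p.2).

Definition op_col X Y Z (A : operator X Y) (B : operator X Z) :
    operator X (hsum Y Z) :=
  Operator (dom A `&` dom B) (fun x => (A x, B x) : hsum Y Z).

Definition op_block X Y (A : operator X X) (B : operator Y X)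
    (C : operator X Y) (D : operator Y Y) : operator (hsum X Y) (hsum X Y) :=
  op_col (op_row A B) (op_row C D).

(** The bounded extension of [S] to the whole space: it is defined at [x] if
    the bounded operators extending [S] exist and all agree at [x]. *)
Definition bounded_ext X Y (S : operator X Y) : operator X Y :=
  op_of_rel (fun x y => exists B : operator X Y,
    [/\ bounded_op B, op_sub S B & B x = y]).

(** The orthogonal projection onto [G]. *)
Definition orthproj X (G : set X) : operator X X :=
  op_of_rel (fun x y => G y /\ forall g, G g -> inner (x - y) g = 0).

Definition unitary_op X (u : operator X X) :=
  [/\ bounded_op u, op_eq (op_mul (op_adj u) u) (op_id X)
    & op_eq (op_mul u (op_adj u)) (op_id X)].

Definition riemann_sphere X : set (operator (hsum X X) (hsum X X)) :=
  let p0 := op_block (op_id X) (op_zero X X) (op_zero X X) (op_zero X X) in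
  [set p | exists u, unitary_op u /\ op_eq p (op_mul (op_mul u p0) (op_adj u))].

End Operators.

Arguments riemann_sphere {R} X _.

Notation "S === T" := (op_eq S T) (at level 70, no associativity) : type_scope.
Notation "0" := (op_zero _ _) : op_scope.
Notation "1" := (op_id _) : op_scope.
Notation "S + T" := (op_add S T) : op_scope.
Notation "S * T" := (op_mul S T) : op_scope.
Notation "T ^-1" := (op_inv T) : op_scope.
Notation "T ^*" := (op_adj T) : op_scope.

(* Main.v *)
(** Let P be the projection onto Gr(T) and Q the one onto H (+) 0. Since
    Gr(T)^perp = {(-T^* k, k)}, the decomposition of (x, 0) along Gr(T) reads
    x = h + T^*T h with P(x, 0) = (h, Th), and that of (0, y) reads
    y = k + TT^* k with P(0, y) = (T^* k, TT^* k); all three formulas follow,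
    the bounded extensions because P(T^* y, 0) = P(0, y) on the dense set
    Dom(T^* ).

    For the Riemann sphere, S = P + Q - 1 is a self-adjoint contraction with
    S P = Q S and P S = S Q, and it is injective because T is single-valued and
    densely defined. Hence u = sgn(S) is a self-adjoint unitary with
    u Q u = P. It is obtained as S |S|^-1 on the dense range of
    |S| = (1 - B)^(1/2), where B = 1 - S^2. *)

From HB Require Import structures.
Require Import Defs.
From mathcomp Require Import all_boot all_order all_algebra.
From mathcomp Require Import all_classical all_reals all_analysis.
From mathcomp Require Import ring lra.
Import numFieldNormedType.Exports.

Set Implicit Arguments.
Unset Strict Implicit.
Unset Printing Implicit Defensive.
Import Order.TTheory GRing.Theory Num.Theory.
Local Open Scope classical_set_scope.
Local Open Scope complex_scope.
Local Open Scope ring_scope.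

(** * The real inner product *)

Section RealInner.
Context {R : realType} {K : hilbertType R}.
Implicit Types (x y z : K) (a : R[i]) (r : R).

(** Norms and inner products take values in [R[i]]; the real inner product
    [rip] determines [inner], since [rip ('i *: x) y] is [- Im (inner x y)], and
    real arithmetic decides the inequalities about [rip] and [nr]. *)
Definition rip x y : R := complex.Re (inner x y).
Definition nr x : R := complex.Re `|x|.

Lemma nrE x : (nr x)%:C = `|x|.
Proof. by rewrite /nr RRe_real// normr_real. Qed.

Lemma nr_ge0 x : 0 <= nr x.
Proof. by rewrite -ler0c nrE. Qed.

Lemma nr0 : nr 0 = 0.
Proof. by rewrite /nr normr0. Qed.

Lemma nr0_eq x : nr x = 0 -> x = 0.
Proof. by move=> x0; apply/normr0_eq0; rewrite -nrE x0. Qed.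

Lemma nrN x : nr (- x) = nr x.
Proof. by rewrite /nr normrN. Qed.

Lemma nr_sub x y : nr (x - y) = nr (y - x).
Proof. by rewrite /nr distrC. Qed.

Lemma nrD x y : nr (x + y) <= nr x + nr y.
Proof. by rewrite -lecR rmorphD/= !nrE ler_normD. Qed.

Lemma nr_triangle z x y : nr (x - y) <= nr (x - z) + nr (z - y).
Proof. by have := nrD (x - z) (z - y); rewrite addrA subrK. Qed.

Lemma nrZ a x : nr (a *: x) = complex.Re `|a| * nr x.
Proof. by apply: complexI; rewrite rmorphM/= !nrE normrZ (RRe_real (normr_real a)). Qed.

Lemma nrZr r x : nr (r%:C *: x) = `|r| * nr x.
Proof. by rewrite nrZ normc_def/= expr0n/= addr0 sqrtr_sqr. Qed.

Lemma rip_nr x : rip x x = nr x ^+ 2.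
Proof. by rewrite /rip inner_norm -nrE -rmorphXn. Qed.

Lemma ripC x y : rip x y = rip y x.
Proof.
rewrite /rip (hermC _ x y) expr0 mul1r.
by set w := inner y x; rewrite -[LHS]/(complex.Re (conjc w)); case: w.
Qed.

Lemma ripDl x y z : rip (x + y) z = rip x z + rip y z.
Proof. by rewrite /rip linearDl raddfD. Qed.

Lemma ripNl x z : rip (- x) z = - rip x z.
Proof. by rewrite /rip linearNl raddfN. Qed.

Lemma ripBl x y z : rip (x - y) z = rip x z - rip y z.
Proof. by rewrite ripDl ripNl. Qed.

Lemma ripDr x y z : rip z (x + y) = rip z x + rip z y.
Proof. by rewrite ripC ripDl !(ripC z). Qed.

Lemma ripNr x z : rip z (- x) = - rip z x.
Proof. by rewrite ripC ripNl (ripC z). Qed.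

Lemma ripBr x y z : rip z (x - y) = rip z x - rip z y.
Proof. by rewrite ripDr ripNr. Qed.

Lemma rip0l z : rip 0 z = 0.
Proof. by have := ripBl z z z; rewrite !subrr. Qed.

Lemma rip0r z : rip z 0 = 0.
Proof. by rewrite ripC rip0l. Qed.

Lemma ripZl r x y : rip (r%:C *: x) y = r * rip x y.
Proof.
by rewrite /rip linearZl_LR/=; case: (inner x y) => u v /=; rewrite mul0r subr0.
Qed.

Lemma ripZr r x y : rip x (r%:C *: y) = r * rip x y.
Proof. by rewrite ripC ripZl ripC. Qed.

Lemma rip_i x y : rip ('i *: x) y = - complex.Im (inner x y).
Proof. by rewrite /rip linearZl_LR/= mulrC ReiNIm. Qed.

(** Multiplication by ['i] is skew for [rip]. Moving it across turns real orthogonality to a complex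
    subspace into complex orthogonality. *)
Lemma rip_iC x y : rip ('i *: x) y = - rip x ('i *: y).
Proof.
rewrite (ripC x) !rip_i opprK (hermC _ x y) expr0 mul1r.
set w := inner y x; rewrite -[LHS]/(- complex.Im (conjc w)).
by case: w => a b /=; rewrite opprK.
Qed.

Lemma nr_sqD x y : nr (x + y) ^+ 2 = nr x ^+ 2 + nr y ^+ 2 + 2 * rip x y.
Proof. by rewrite -!rip_nr ripDl !ripDr (ripC y x); ring. Qed.

Lemma nr_sqB x y : nr (x - y) ^+ 2 = nr x ^+ 2 + nr y ^+ 2 - 2 * rip x y.
Proof. by rewrite nr_sqD nrN ripNr mulrN. Qed.

Lemma rip_le x y : `|rip x y| <= nr x * nr y.
Proof.
have [x0|x0] := eqVneq (nr x) 0.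
  by rewrite (nr0_eq x0) rip0l normr0 nr0 mul0r.
rewrite -(@ler_pXn2r _ 2) ?nnegrE ?mulr_ge0 ?nr_ge0//.
rewrite real_normK ?num_real// -subr_ge0.
have xp : 0 < nr x ^+ 2 by rewrite exprn_gt0// lt_neqAle eq_sym x0 nr_ge0.
rewrite -(pmulr_lge0 _ xp).
(* Cauchy-Schwarz: the difference, scaled by [nr x ^+ 2], is the squared norm of a multiple of the
   component of [y] orthogonal to [x]. *)
suff -> : ((nr x * nr y) ^+ 2 - rip x y ^+ 2) * nr x ^+ 2 =
  nr ((nr x ^+ 2)%:C *: y - (rip x y)%:C *: x) ^+ 2 by exact: sqr_ge0.
rewrite nr_sqB !nrZr ripZl ripZr (ripC y x) !exprMn !real_normK ?num_real//.
ring.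
Qed.

Lemma nr_le_sq x r : 0 <= r -> (nr x <= r) = (nr x ^+ 2 <= r ^+ 2).
Proof. by move=> r0; rewrite ler_pXn2r// nnegrE nr_ge0. Qed.

Lemma rip_eq x y : (forall z, rip z x = rip z y) -> x = y.
Proof.
move=> h; apply/eqP; rewrite -subr_eq0; apply/eqP/nr0_eq/eqP.
have : nr (x - y) ^+ 2 == 0 by rewrite -rip_nr ripBr h subrr.
by rewrite expf_eq0.
Qed.

(** The Archimedean property stands in for passing to the limit in estimates with rate
    [c / n.+1]. *)
Lemma arch_le0 (a c : R) : (forall n, a <= c / n.+1%:R) -> a <= 0.
Proof.
move=> h; rewrite leNgt; apply/negP => a0.
have c0 : 0 <= c by have := h 0; rewrite divr1; lra.
have /(_ (c / a)) := @Num.Theory.archi_boundP R.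
rewrite divr_ge0 ?(ltW a0)// => /(_ isT).
set n := Num.bound _ => hn; have := h n; rewrite leNgt => /negP; apply.
rewrite ltr_pdivrMr ?ltr0n//; move: hn; rewrite ltr_pdivrMr// => /lt_le_trans; apply.
by rewrite mulrC ler_pM2l// ler_nat.
Qed.

Lemma arch_exists (c e : R) : 0 < e -> exists n, c / n.+1%:R < e.
Proof.
move=> e0; apply: contrapT => h.
have : e <= 0; last by rewrite leNgt e0.
by apply: (@arch_le0 _ c) => n; rewrite leNgt; apply/negP => ce; apply: h; exists n.
Qed.

Lemma ball_nr x (e : R[i]) : 0 < e -> ball x e = [set y | nr (x - y) < complex.Re e].
Proof.
move=> e0; apply/seteqP; split=> y; rewrite -ball_normE /= -nrE.
  by rewrite ltcE/= => /andP[].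
by move=> h; rewrite -(RRe_real (gtr0_real e0)) ltcR.
Qed.

Lemma dense_nr (D : set K) : dense D ->
  forall x e, 0 < e -> exists2 d, D d & nr (x - d) < e.
Proof.
move=> Dd x e e0; have e0C : 0 < e%:C :> R[i] by rewrite ltcR.
have [|d []] := Dd (ball x e%:C) _ (ball_open _ _).
  by exists x; exact: ballxx.
by rewrite ball_nr//= => xd Ddd; exists d.
Qed.

(** All limits below are taken along sequences with an explicit rate [c / n.+1]. *)
Definition rate_closed (G : set K) := forall (u : nat -> K) l c,
  (forall n, G (u n)) -> (forall n, nr (u n - l) <= c / n.+1%:R) -> G l.

Lemma closed_rate_closed (G : set K) : closed G -> rate_closed G.
Proof.
move=> Gc u l c Gu ul; rewrite (closure_id G).1// => B /nbhs_ballP[e e0 lB].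
have e0r : 0 < complex.Re e by move: e0; rewrite /= ltcE => /andP[].
have [n ne] := arch_exists c e0r.
exists (u n); split=> //; apply: lB; rewrite ball_nr//= nr_sub.
exact: le_lt_trans (ul n) ne.
Qed.

Lemma complete_rate (u : nat -> K) c :
  (forall m n, (m <= n)%N -> nr (u m - u n) <= c / m.+1%:R) ->
  exists l, forall n, nr (u n - l) <= c / n.+1%:R.
Proof.
move=> uc.
have /cauchy_cvg /cvg_ex[l ul] : cauchy (u @ \oo).
  apply: cauchy_exP => e e0.
  have e0r : 0 < complex.Re e by move: e0; rewrite /= ltcE => /andP[].
  have [N Ne] := arch_exists c e0r.
  exists (u N); exists N => // n /= Nn; rewrite ball_nr//=.
  exact: le_lt_trans (uc _ _ Nn) Ne.
exists l => n; apply/ler_addgt0Pr => e e0.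
have e0C : 0 < e%:C :> R[i] by rewrite ltcR.
have [N _ hN] : \forall m \near \oo, ball l e%:C (u m).
  by apply: ul; exact: nbhsx_ballx.
(* The index [maxn N n] is late enough to be [e]-close to [l] and, being at least [n], to obey the
   rate at [n]. *)
have := hN (maxn N n) (leq_maxl _ _); rewrite ball_nr//= => le.
apply: le_trans (nr_triangle (u (maxn N n)) _ _) _.
by apply: lerD; [exact: uc (leq_maxr _ _)|rewrite nr_sub; exact: ltW].
Qed.

End RealInner.

(** * Orthogonal projections *)

Section Projection.
Context {R : realType} {K : hilbertType R}.
Implicit Types (x y z : K) (G D : set K).

Definition lsubspace G := G 0 /\ forall (a : R[i]) x y, G x -> G y -> G (a *: x + y).

Lemma subspaceD G x y : lsubspace G -> G x -> G y -> G (x + y).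
Proof. by move=> [_ h] Gx Gy; rewrite -[x]scale1r; apply: h. Qed.

Lemma subspaceZ G (a : R[i]) x : lsubspace G -> G x -> G (a *: x).
Proof. by move=> [G0 h] Gx; rewrite -[_ *: _]addr0; apply: h. Qed.

Lemma subspaceN G x : lsubspace G -> G x -> G (- x).
Proof. by move=> GS Gx; rewrite -scaleN1r; apply: subspaceZ. Qed.

Lemma subspaceB G x y : lsubspace G -> G x -> G y -> G (x - y).
Proof. by move=> GS Gx Gy; apply: subspaceD => //; apply: subspaceN. Qed.

(** The parallelogram law for [z - x] and [z - y], whose sum is twice [z] minus the midpoint of [x]
    and [y]. *)
Lemma nr_parallelogram x y z : nr (x - y) ^+ 2 =
  2 * nr (z - x) ^+ 2 + 2 * nr (z - y) ^+ 2 - 4 * nr (z - (2^-1)%:C *: (x + y)) ^+ 2.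
Proof.
rewrite !nr_sqB nrZr ripZr exprMn real_normK ?num_real// nr_sqD ripDr.
by field.
Qed.

(** A minimising sequence for the distance to [G] is Cauchy by the parallelogram law, and a first
    variation at its limit gives orthogonality. *)
Lemma projection_exists G : lsubspace G -> rate_closed G ->
  forall x, exists2 p, G p & forall g, G g -> rip (x - p) g = 0.
Proof.
move=> GS Gc x; pose A := [set nr (x - g) ^+ 2 | g in G]; pose d := inf A.
have Ainf : has_inf A.
  split; first by exists (nr (x - 0) ^+ 2); exists 0 => //; exact: GS.1.
  by exists 0 => _ [g _ <-]; exact: sqr_ge0.
have d_le g : G g -> d <= nr (x - g) ^+ 2.
  by move=> Gg; apply: ge_inf; [exact: Ainf.2|exists g].
have d0 : 0 <= d.
  by apply: lb_le_inf; [exact: Ainf.1|move=> _ [g _ <-]; exact: sqr_ge0].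
have /choice[u uP] : forall n : nat, exists g, G g /\
    nr (x - g) ^+ 2 < d + (1 / n.+1%:R) ^+ 2.
  move=> n; have e0 : 0 < (1 / n.+1%:R) ^+ 2 :> R by rewrite exprn_gt0// divr_gt0.
  by have [_ [g Gg <-] h] := inf_adherent e0 Ainf; exists g.
have [p up] : exists l, forall n, nr (u n - l) <= 2 / n.+1%:R.
  apply: complete_rate => m n mn.
  rewrite nr_le_sq ?divr_ge0// (nr_parallelogram _ _ x).
  (* The midpoint lies in [G], so its squared distance is at least [d]. What remains is at most
     [2 / m.+1 ^+ 2 + 2 / n.+1 ^+ 2], hence at most [(2 / m.+1) ^+ 2]. *)
  have Gmid := subspaceZ (2^-1)%:C GS (subspaceD GS (uP m).1 (uP n).1).
  have := d_le _ Gmid.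
  have := (uP m).2; have := (uP n).2.
  have : (1 / n.+1%:R) ^+ 2 <= (1 / m.+1%:R) ^+ 2 :> R.
    by rewrite ler_pXn2r ?nnegrE ?divr_ge0// ler_pM2l// lef_pV2 ?posrE// ler_nat ltnS.
  rewrite !exprMn expr1n !mul1r.
  move: (nr (x - u m) ^+ 2) (nr (x - u n) ^+ 2) (nr _ ^+ 2) => a b e.
  by move: (m.+1%:R^-1 ^+ 2) (n.+1%:R^-1 ^+ 2) => s t; lra.
have Gp : G p by apply: (Gc u p 2) => // n; exact: (uP n).1.
have xp : nr (x - p) <= Num.sqrt d.
  (* The constant 3 adds 1 from near-minimality of [u n] and 2 from its distance to [p]. *)
  rewrite -subr_le0; apply: (@arch_le0 _ _ 3) => n.
  have := nr_triangle (u n) x p; have := up n.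
  suff : nr (x - u n) <= Num.sqrt d + 1 / n.+1%:R by set t := n.+1%:R^-1; lra.
  rewrite nr_le_sq ?addr_ge0 ?sqrtr_ge0 ?divr_ge0//.
  apply: le_trans (ltW (uP n).2) _; rewrite sqrrD sqr_sqrtr// lerD2r lerDl.
  by rewrite mulrn_wge0// mulr_ge0 ?sqrtr_ge0 ?divr_ge0.
have {}xp : nr (x - p) ^+ 2 <= d.
  by rewrite nr_le_sq ?sqrtr_ge0// sqr_sqrtr in xp.
exists p => // g Gg; set r := rip (x - p) g; set N := nr g ^+ 2.
have N0 : 0 < N + 1 by rewrite ltr_wpDl ?sqr_ge0.
(* The optimal coefficient would be [r / N]; with [N + 1] the case [g = 0] needs no separate
   treatment. *)
have := d_le (p + (r / (N + 1))%:C *: g) (subspaceD GS Gp (subspaceZ _ GS Gg)).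
rewrite opprD addrA nr_sqB nrZr ripZr exprMn real_normK ?num_real// -/r -/N.
move=> /(le_trans xp) h.
have : 0 <= (r / (N + 1)) ^+ 2 * N - 2 * (r / (N + 1) * r) by lra.
have -> : (r / (N + 1)) ^+ 2 * N - 2 * (r / (N + 1) * r) =
    - (r ^+ 2 * ((N + 2) / (N + 1) ^+ 2)).
  by field; rewrite gt_eqF.
rewrite oppr_ge0 pmulr_lle0 ?divr_gt0 ?exprn_gt0//; last first.
  by rewrite ltr_wpDl ?sqr_ge0.
move=> r2; apply/eqP; have : r ^+ 2 == 0 by rewrite eq_le r2 sqr_ge0.
by rewrite expf_eq0.
Qed.

(** The closure [G] of [D] is a closed subspace. The difference between [x] and its projection to
    [G] is orthogonal to [D], hence zero. *)
Lemma dense_of_orthogonal D : lsubspace D ->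
  (forall y, (forall d, D d -> rip d y = 0) -> y = 0) ->
  forall x e, 0 < e -> exists2 d, D d & nr (x - d) < e.
Proof.
move=> DS D0; pose G := [set x | forall e, 0 < e -> exists2 d, D d & nr (x - d) < e].
have DG d : D d -> G d by move=> Dd e e0; exists d => //; rewrite subrr nr0.
have GS : lsubspace G.
  split; first exact: DG DS.1.
  move=> a x y Gx Gy e e0.
  pose b := complex.Re `|a|; have b0 : 0 <= b by rewrite -ler0c RRe_real ?normr_real.
  (* Dividing by [b + 1] rather than [b] covers [a = 0]. *)
  have [|d1 Dd1 xd1] := Gx (e / 2 / (b + 1)); first by rewrite !divr_gt0// ltr_wpDl.
  have [|d2 Dd2 xd2] := Gy (e / 2); first by rewrite divr_gt0.
  exists (a *: d1 + d2); first exact: DS.2.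
  rewrite opprD addrACA -scalerBr (le_lt_trans (nrD _ _))// nrZ -/b.
  rewrite (splitr e) ler_ltD//.
  have /le_trans : b * nr (x - d1) <= (b + 1) * nr (x - d1).
    by rewrite ler_wpM2r ?nr_ge0// lerDl.
  apply; rewrite mulrC -ler_pdivlMr ?ltW//.
  by rewrite ltr_wpDl.
have Gc : rate_closed G.
  move=> u l c Gu ul e e0.
  have [|n ne] := @arch_exists _ c (e / 2); first by rewrite divr_gt0.
  have [|d Dd ud] := Gu n (e / 2); first by rewrite divr_gt0.
  exists d => //; have := nr_triangle (u n) l d; have := ul n; rewrite nr_sub.
  move: (c / _) (nr _) (nr _) (nr _) ne ud => *; lra.
move=> x; have [p Gp xp] := projection_exists GS Gc x.
suff -> : x = p by [].
apply/eqP; rewrite -subr_eq0; apply/eqP/D0 => d Dd.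
by rewrite ripC xp//; exact: DG.
Qed.

(** Approximating [z] itself by [d] in [D], the square of [nr z] equals [rip (z - d) z], at most
    [nr (z - d) * nr z]. *)
Lemma eq0_of_dense D z : (forall x e, 0 < e -> exists2 d, D d & nr (x - d) < e) ->
  (forall d, D d -> rip d z = 0) -> z = 0.
Proof.
move=> Dd Dz; apply: nr0_eq; apply/eqP; rewrite eq_le nr_ge0 andbT.
apply/ler_addgt0Pr => e e0; have [d Ddd de] := Dd z e e0.
have := rip_le (z - d) z; rewrite ripBl (Dz d)// subr0 rip_nr.
rewrite normrX ger0_norm ?nr_ge0//.
rewrite add0r expr2; have := nr_ge0 z; rewrite le_eqVlt => /orP[/eqP<-|z0].
  by move=> _; exact: ltW.
by rewrite ler_pM2r// => /le_trans; apply; exact: ltW.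
Qed.

End Projection.

(** * Square roots of positive contractions *)

Section LinearMaps.
Context {R : realType} {K L : hilbertType R}.
Variable f : K -> L.
Hypothesis lf : linear f.

Let F : {linear K -> L} := HB.pack f (GRing.isLinear.Build R[i] K L *:%R f lf).

Lemma lin0 : f 0 = 0. Proof. exact: (linear0 F). Qed.
Lemma linN x : f (- x) = - f x. Proof. exact: (linearN F). Qed.
Lemma linD x y : f (x + y) = f x + f y. Proof. exact: (linearD F). Qed.
Lemma linB x y : f (x - y) = f x - f y. Proof. exact: (linearB F). Qed.
Lemma linZ a x : f (a *: x) = a *: f x. Proof. exact: (linearZ_LR F). Qed.
End LinearMaps.

Section Limits.
Context {R : realType} {K : hilbertType R}.

Lemma rate_unique (u : nat -> K) (x y : K) (c d : R) :
  (forall n, nr (u n - x) <= c / n.+1%:R) ->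
  (forall n, nr (u n - y) <= d / n.+1%:R) -> x = y.
Proof.
move=> ux uy; apply/eqP; rewrite -subr_eq0; apply/eqP/nr0_eq/eqP.
rewrite eq_le nr_ge0 andbT; apply: (@arch_le0 _ _ (c + d)) => n.
rewrite (le_trans (nr_triangle (u n) x y))// mulrDl lerD//.
by rewrite nr_sub.
Qed.

End Limits.

Section SquareRoot.
Context {R : realType} {K : hilbertType R}.
Variable B : K -> K.
Hypothesis B_lin : linear B.
Hypothesis B_sym : forall x y, rip (B x) y = rip x (B y).
Hypothesis B_le : forall x, nr (B x) <= nr x.

(** [Y = 1 - (1 - B)^(1/2)] is the fixed point of [Y |-> (B + Y^2) / 2]. The
    scalar iteration for [B = 1] dominates it and converges to [1]. *)
Fixpoint sqrt_iter n x : K :=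
  if n is m.+1 then (2^-1)%:C *: (B x + sqrt_iter m (sqrt_iter m x)) else 0.

Fixpoint sqrt_iter_bound n : R :=
  if n is m.+1 then 2^-1 * (1 + sqrt_iter_bound m ^+ 2) else 0.

Local Notation Y := sqrt_iter.
Local Notation b := sqrt_iter_bound.

Lemma sqrt_iter_bound01 n : 0 <= b n <= 1.
Proof.
by elim: n => [|n /andP[IH0 IH1]] /=; [rewrite lexx ler01|apply/andP; split; nra].
Qed.

Lemma sqrt_iter_bound_ge n : 1 - b n <= 2 / n.+1%:R.
Proof.
elim: n => [|n IH]; first by rewrite /= divr1; lra.
have /andP[b0 b1] := sqrt_iter_bound01 n; rewrite [b n.+1]/=.
set d := 1 - b n in IH; have {b0} d1 : d <= 1 by rewrite /d; lra.
rewrite -[b n](subKr 1) -/d; move: IH; rewrite !ler_pdivlMr// -[n.+2%:R]natr1.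
move: n.+1%:R => s ds.
(* With [d = 1 - b n] the recursion reads [d - d ^+ 2 / 2]. The expression is twice the gap in the
   bound to be proved, and [d * s <= 2] is the induction hypothesis. *)
suff : 0 <= (2 - d * s) * (2 - d) + d ^+ 2 by lra.
by rewrite addr_ge0 ?sqr_ge0// mulr_ge0; lra.
Qed.

Lemma sqrt_iter_lin n : linear (Y n).
Proof.
elim: n => [|n IH] a x y /=; first by rewrite scaler0 addr0.
by rewrite B_lin !IH addrACA -scalerDr [LHS]scalerDr !scalerA mulrC.
Qed.

Lemma sqrt_iter_sym n x y : rip (Y n x) y = rip x (Y n y).
Proof.
elim: n x y => [|n IH] x y /=; first by rewrite rip0l rip0r.
by rewrite ripZl ripZr ripDl ripDr B_sym !IH.
Qed.

Lemma sqrt_iter_le n x : nr (Y n x) <= b n * nr x.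
Proof.
elim: n x => [|n IH] x /=; first by rewrite nr0 mul0r.
rewrite nrZr ger0_norm// -mulrA ler_pM2l// (le_trans (nrD _ _))// mulrDl mul1r.
rewrite lerD// (le_trans (IH _))// expr2 -mulrA ler_wpM2l//.
by case/andP: (sqrt_iter_bound01 n).
Qed.

(** Each iterate is a polynomial in [B]. *)
Lemma sqrt_iter_comm F n x : linear F -> (forall x, F (B x) = B (F x)) ->
  F (Y n x) = Y n (F x).
Proof.
move=> lF FB; elim: n x => [|n IH] x /=; first exact: lin0.
by rewrite (linZ lF) (linD lF) FB !IH.
Qed.

Lemma sqrt_iter_commute m n x : Y m (Y n x) = Y n (Y m x).
Proof.
apply: sqrt_iter_comm => [|{}x]; first exact: sqrt_iter_lin.
by apply/esym/sqrt_iter_comm.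
Qed.

(** As the iterates commute, a difference of squares factors: [Y n.+2 - Y n.+1] is half of
    [Y n.+1 - Y n] applied to [Y n.+1 + Y n]. The scalars [b] factor in the same way. *)
Lemma sqrt_iter_step n x : nr (Y n.+1 x - Y n x) <= (b n.+1 - b n) * nr x.
Proof.
elim: n x => [|n IH] x.
  rewrite /= addr0 !subr0 expr0n/= addr0 mulr1 nrZr ger0_norm//.
  by rewrite ler_pM2l.
have -> : Y n.+2 x - Y n.+1 x = (2^-1)%:C *:
    (Y n.+1 (Y n.+1 x + Y n x) - Y n (Y n.+1 x + Y n x)).
  rewrite (linD (sqrt_iter_lin n.+1)) (linD (sqrt_iter_lin n)).
  have E m z : Y m.+1 z = (2^-1)%:C *: (B z + Y m (Y m z)) by [].
  rewrite [Y n.+2 x]E [X in _ - X = _]E -scalerBr (sqrt_iter_commute n n.+1).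
  by rewrite [in RHS]opprD [in RHS]addrA addrK opprD addrACA subrr add0r.
rewrite nrZr ger0_norm//.
have -> : (b n.+2 - b n.+1) * nr x =
    2^-1 * ((b n.+1 - b n) * ((b n.+1 + b n) * nr x)).
  by rewrite /=; ring.
rewrite ler_pM2l// (le_trans (IH _))// ler_wpM2l//.
  have /andP[_ h] := sqrt_iter_bound01 n; rewrite /=.
  by nra.
by rewrite mulrDl (le_trans (nrD _ _))// lerD// sqrt_iter_le.
Qed.

(** The steps telescope to [b n - b m], which is at most [1 - b m]. *)
Lemma sqrt_iter_cauchy m n x : (m <= n)%N ->
  nr (Y m x - Y n x) <= 2 * nr x / m.+1%:R.
Proof.
move=> mn; have : nr (Y m x - Y n x) <= (b n - b m) * nr x.
  elim: n mn => [|n IH]; first by rewrite leqn0 => /eqP->; rewrite !subrr nr0 mul0r.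
  rewrite leq_eqVlt => /orP[/eqP->|/IH h]; first by rewrite !subrr nr0 mul0r.
  have := nr_triangle (Y n x) (Y m x) (Y n.+1 x).
  have := sqrt_iter_step n x; rewrite nr_sub => h1 /le_trans; apply.
  apply: le_trans (lerD h h1) _.
  by rewrite -mulrDl [X in X * _]addrC addrA subrK.
move=> /le_trans; apply; rewrite mulrAC ler_wpM2r ?nr_ge0//.
rewrite (le_trans _ (sqrt_iter_bound_ge m))// lerB//.
by case/andP: (sqrt_iter_bound01 n).
Qed.

Lemma sqrt_iter_limit : exists L : K -> K,
  forall x n, nr (Y n x - L x) <= 2 * nr x / n.+1%:R.
Proof.
suff /choice[L YL] : forall x, exists l, forall n, nr (Y n x - l) <= 2 * nr x / n.+1%:R.
  by exists L.
by move=> x; apply: complete_rate => m n; exact: sqrt_iter_cauchy.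
Qed.

(** With [L] the limit of the iterates, [C = 1 - L], and [2 L = B + L^2] gives [C^2 = 1 - B].
    Commutation with [F] passes from the iterates to the limit. *)
Lemma square_root : exists C : K -> K,
  [/\ linear C, forall x y, rip (C x) y = rip x (C y),
      forall x, C (C x) = x - B x &
      forall F M, linear F -> (forall x, nr (F x) <= M * nr x) ->
        (forall x, F (B x) = B (F x)) -> forall x, F (C x) = C (F x)].
Proof.
have [L YL] := sqrt_iter_limit.
have L_lin : linear L.
  move=> a x y; apply: (rate_unique (YL _)) => n.
  instantiate (1 := complex.Re `|a| * (2 * nr x) + 2 * nr y).
  rewrite sqrt_iter_lin opprD addrACA -scalerBr (le_trans (nrD _ _))// nrZ mulrDl.
  rewrite lerD ?YL// -mulrA ler_wpM2l ?YL// -ler0c RRe_real ?normr_real//.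
have L_sym x y : rip (L x) y = rip x (L y).
  apply/eqP; rewrite -subr_eq0 -normr_eq0 eq_le normr_ge0 andbT.
  apply: (@arch_le0 _ _ (4 * nr x * nr y)) => n.
  have -> : rip (L x) y - rip x (L y) =
      rip x (Y n y - L y) - rip (Y n x - L x) y.
    by rewrite ripBr ripBl sqrt_iter_sym; ring.
  rewrite (le_trans (ler_normB _ _))//.
  have h1 := le_trans (rip_le _ _) (ler_wpM2l (nr_ge0 x) (YL y n)).
  have h2 := le_trans (rip_le _ _) (ler_wpM2r (nr_ge0 y) (YL x n)).
  by apply: le_trans (lerD h1 h2) _; rewrite le_eqVlt; apply/orP; left; apply/eqP; ring.
have L_fix x : L x = (2^-1)%:C *: (B x + L (L x)).
  (* The shifted sequence tends to [L x], and by its recursion also to the right-hand side. *)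
  apply: (@rate_unique _ _ (fun n => Y n.+1 x) _ _ (2 * nr x)
    (2^-1 * (2 * nr x + 2 * nr (L x)))) => n.
    rewrite (le_trans (YL _ _))// ler_wpM2l ?mulr_ge0 ?nr_ge0//.
    by rewrite lef_pV2 ?posrE// ler_nat.
  rewrite /= -scalerBr nrZr ger0_norm// -mulrA ler_pM2l// opprD addrACA subrr add0r.
  rewrite mulrDl (le_trans (nr_triangle (Y n (L x)) _ _))// lerD//.
  rewrite -(linB (sqrt_iter_lin n)) (le_trans (sqrt_iter_le _ _))//.
  rewrite (le_trans _ (YL x n))// -[leRHS]mul1r ler_wpM2r ?nr_ge0//.
  by case/andP: (sqrt_iter_bound01 n).
exists (fun x => x - L x); split.
- by move=> a x y; rewrite L_lin opprD addrACA scalerBr.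
- by move=> x y; rewrite ripBl ripBr L_sym.
- move=> x; rewrite (linB L_lin) opprD opprK addrA.
  have two : L x + L x = B x + L (L x).
    rewrite {1 2}(L_fix x) -scalerDl -rmorphD/=.
    by have -> : 2^-1 + 2^-1 = 1 :> R; [field|rewrite scale1r].
  by rewrite -[x - L x - L x]addrA -opprD two opprD addrA subrK.
- move=> F M lF FM FB x; rewrite (linB lF); congr (_ - _).
  apply: (@rate_unique _ _ (fun n => Y n (F x)) _ _
    (`|M| * (2 * nr x)) (2 * nr (F x))) => n; last exact: YL.
  rewrite -(sqrt_iter_comm _ _ lF FB) -(linB lF) (le_trans (FM _))//.
  by rewrite -mulrA (le_trans (ler_wpM2r (nr_ge0 _) (ler_norm M)))// ler_wpM2l//.
Qed.

End SquareRoot.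

(** * The sign of an injective self-adjoint contraction *)

Section Sign.
Context {R : realType} {K : hilbertType R}.

(** [u] is the sign of [S], characterised by [C \o u = S] with [C = |S|]. *)
Lemma sign_exists (S : K -> K) : linear S ->
  (forall x y, rip (S x) y = rip x (S y)) -> (forall x, nr (S x) <= nr x) ->
  (forall x, S x = 0 -> x = 0) ->
  exists u : K -> K, [/\ linear u, forall x y, rip (u x) y = rip x (u y),
    forall x, u (u x) = x &
    forall F G M N, linear F -> linear G ->
      (forall x, nr (F x) <= M * nr x) -> (forall x, nr (G x) <= N * nr x) ->
      (forall x, F (S x) = S (G x)) -> (forall x, G (S x) = S (F x)) ->
      forall x, F (u x) = u (G x)].
Proof.
move=> S_lin S_sym S_le S_inj.
pose B x := x - S (S x).
have B_lin : linear B.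
  by move=> a x y; rewrite /B !S_lin opprD addrACA scalerBr.
have B_sym x y : rip (B x) y = rip x (B y) by rewrite ripBl ripBr !S_sym.
have B_le x : nr (B x) <= nr x.
  (* The square of [nr (B x)] is that of [nr x], plus that of [nr (S (S x))], minus twice that of
     [nr (S x)]. *)
  rewrite nr_le_sq ?nr_ge0// nr_sqB -S_sym rip_nr.
  have : nr (S (S x)) ^+ 2 <= nr (S x) ^+ 2 by rewrite -nr_le_sq ?nr_ge0.
  by have := sqr_ge0 (nr (S x)); lra.
have [C [C_lin C_sym CC C_comm]] := square_root B_lin B_sym B_le.
have {}CC x : C (C x) = S (S x) by rewrite CC /B opprB addrC subrK.
have SC x : S (C x) = C (S x).
  apply: (C_comm _ 1) => // [y|y]; first by rewrite mul1r.
  by rewrite /B (linB S_lin).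
have nrCS x : nr (C x) = nr (S x).
  apply/eqP; rewrite -(@eqrXn2 _ 2) ?nr_ge0//.
  by rewrite -!rip_nr C_sym CC S_sym.
have C_inj x y : C x = C y -> x = y.
  move=> /eqP; rewrite -subr_eq0 -(linB C_lin) => /eqP Cxy.
  apply/eqP; rewrite -subr_eq0; apply/eqP/S_inj/nr0_eq.
  by rewrite -nrCS Cxy nr0.
have C_dense : forall x e, 0 < e -> exists2 d, range C d & nr (x - d) < e.
  apply: dense_of_orthogonal.
    split; first by exists 0 => //; exact: lin0.
    move=> a _ _ [x _ <-] [y _ <-]; exists (a *: x + y) => //; exact: C_lin.
  (* A vector orthogonal to the range of the symmetric map [C] lies in its kernel, which is
     trivial. *)
  move=> y Cy; apply: C_inj; rewrite (lin0 C_lin); apply: rip_eq => x.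
  by rewrite -C_sym rip0r; apply: Cy; exists x.
(* [w] is the limit of [S x_n] along [C x_n --> z], a Cauchy sequence since
   [C] and [S] have the same norms. *)
have /choice[u uP] z : exists w, C w = S z /\ forall n : nat, exists x,
    nr (C x - z) <= 2 / n.+1%:R /\ nr (S x - w) <= 2 / n.+1%:R.
  have /choice[x xP] (n : nat) : exists x, nr (z - C x) < 1 / n.+1%:R.
    by have [|_ [x _ <-] h] := C_dense z (1 / n.+1%:R); [rewrite divr_gt0|exists x].
  have [w xw] : exists w, forall n, nr (S (x n) - w) <= 2 / n.+1%:R.
    apply: (@complete_rate _ _ (fun n => S (x n))) => m n mn.
    rewrite -(linB S_lin) -nrCS (linB C_lin) (le_trans (nr_triangle z _ _))//.
    rewrite [2]mulr2n mulrDl lerD//; first by rewrite nr_sub ltW.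
    rewrite (le_trans (ltW (xP n)))// ler_pM2l//.
    by rewrite lef_pV2 ?posrE// ler_nat ltnS.
  exists w; split; last first.
    move=> n; exists (x n); split=> //; rewrite nr_sub (le_trans (ltW (xP n)))//.
    by rewrite ler_pM2r ?invr_gt0// ler1n.
  (* [C (S (x n)) = S (C (x n))] tends to both [C w] and [S z]. *)
  apply: (@rate_unique _ _ (fun n => C (S (x n))) _ _ 2 1) => n.
    by rewrite -(linB C_lin) nrCS (le_trans (S_le _)).
  by rewrite -SC -(linB S_lin) (le_trans (S_le _))// nr_sub ltW.
have Cu z : C (u z) = S z by case: (uP z).
have uC z : u (C z) = S z by apply: C_inj; rewrite Cu SC.
have Su z : S (u z) = u (S z) by apply: C_inj; rewrite -SC !Cu.
have u_lin : linear u.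
  by move=> a x y; apply: C_inj; rewrite C_lin !Cu S_lin.
exists u; split=> //.
- move=> x v; apply/eqP; rewrite -subr_eq0 -normr_eq0 eq_le normr_ge0 andbT.
  apply: (@arch_le0 _ _ (2 * (nr v + nr (u v)))) => n.
  have [y [yx yu]] := (uP x).2 n.
  (* Here [C y] is close to [x] and [S y] to [u x], while [rip (C y) (u v) = rip (S y) v] holds
     exactly. *)
  have -> : rip (u x) v - rip x (u v) =
      rip (C y - x) (u v) - rip (S y - u x) v.
    by rewrite !ripBl C_sym Cu S_sym; ring.
  rewrite (le_trans (ler_normB _ _))// mulrDr mulrDl addrC.
  rewrite lerD// (le_trans (rip_le _ _))// mulrAC ler_wpM2r ?nr_ge0//.
- by move=> x; apply/C_inj/C_inj; rewrite !Cu Su Cu CC.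
- move=> F G M N lF lG FM GN FS GS x; apply: C_inj.
  (* [F] commutes with [S^2], hence with [C]; so [C (F (u x)) = F (S x) = S (G x) = C (u (G x))]. *)
  rewrite -(C_comm F M) ?Cu//.
  by move=> y; rewrite /B (linB lF) FS GS.
Qed.

End Sign.

(** * Partial operators as relations *)

Section OperatorGraphs.
Context {R : realType}.
Implicit Types X Y Z : hilbertType R.

(** [T], its values off the domain being ignored, is determined by this relation. *)
Definition maps_to X Y (T : operator X Y) x y := dom T x /\ T x = y.

Lemma op_eqP X Y (S T : operator X Y) :
  (forall x y, maps_to S x y <-> maps_to T x y) -> S === T.
Proof.
move=> ST; split.
  apply/seteqP; split=> x Dx; first by have [] := (ST x (S x)).1 (conj Dx erefl).
  by have [] := (ST x (T x)).2 (conj Dx erefl).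
by move=> x /set_mem Dx; have [_] := (ST x (S x)).1 (conj Dx erefl).
Qed.

Lemma maps_to_rel X Y (G : X -> Y -> Prop) x y :
  maps_to (op_of_rel G) x y <-> G x y /\ forall y', G x y' -> y' = y.
Proof.
split=> [[[z [Gz zu]] <-]|[Gy yu]].
  have Gx : G x (op_of_rel G x) by apply: (@xgetI _ 0 [set y | G x y] z).
  by split=> // y' /zu <-; exact: zu.
have h : exists! y, G x y by exists y; split=> // y' /yu.
by split=> //; apply: yu; apply: (@xgetI _ 0 [set y | G x y] y).
Qed.

Lemma maps_to_mul X Y Z (S : operator Y Z) (T : operator X Y) x z :
  maps_to (op_mul S T) x z <-> exists y, maps_to T x y /\ maps_to S y z.
Proof.
split=> [[[Tx Sx] <-]|[y [[Tx <-] [Sx <-]]]]; last by split.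
by exists (T x); split.
Qed.

Lemma maps_to_inv X Y (T : operator X Y) x y :
  maps_to (op_inv T) y x <-> maps_to T x y /\ forall x', maps_to T x' y -> x' = x.
Proof. exact: maps_to_rel. Qed.

Lemma maps_to_total X Y (T : operator X Y) (f : X -> Y) :
  (forall x y, maps_to T x y <-> y = f x) -> dom T = setT /\ T =1 f.
Proof.
move=> Tf; split; last by move=> x; have [] := (Tf x (f x)).2 erefl.
by apply/seteqP; split=> // x _; have [] := (Tf x (f x)).2 erefl.
Qed.

Lemma bounded_opP X Y (T : operator X Y) : bounded_op T ->
  [/\ dom T = setT, linear T & exists M : R, forall x, nr (T x) <= M * nr x].
Proof.
move=> [domT [_ T_lin] [M TM]]; split=> //.
  by move=> a x y; apply: (T_lin a x y _ _).2; rewrite domT.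
exists (complex.Re M) => x; have := TM x; rewrite lecE -!nrE => /andP[_].
by case: M {TM} => a b /=; rewrite mulr0 subr0.
Qed.

Lemma bounded_op_of_fun X Y (T : operator X Y) (f : X -> Y) (M : R) :
  linear f -> (forall x, nr (f x) <= M * nr x) ->
  (forall x y, maps_to T x y <-> y = f x) -> bounded_op T.
Proof.
move=> f_lin fM /maps_to_total[domT Tf]; split=> //.
  split; first by rewrite domT.
  by move=> a x y _ _; rewrite domT; split=> //; rewrite !Tf f_lin.
by exists M%:C => x; rewrite Tf -!nrE -rmorphM/= lecR.
Qed.

Lemma linear_eq_on_dense X Y (f g : X -> Y) (M N : R) (D : set X) :
  linear f -> linear g ->
  (forall x, nr (f x) <= M * nr x) -> (forall x, nr (g x) <= N * nr x) ->
  (forall x e, 0 < e -> exists2 d, D d & nr (x - d) < e) ->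
  (forall d, D d -> f d = g d) -> f =1 g.
Proof.
move=> lf lg fM gN Dd fg x; apply/eqP; rewrite -subr_eq0; apply/eqP/nr0_eq/eqP.
rewrite eq_le nr_ge0 andbT; apply: (@arch_le0 _ _ (`|M| + `|N|)) => n.
have [|d Ddd xd] := Dd x (1 / n.+1%:R); first by rewrite divr_gt0.
have -> : f x - g x = f (x - d) - g (x - d).
  by rewrite (linB lf) (linB lg) (fg d)// opprB addrA subrK.
rewrite (le_trans (nrD _ _))// nrN (le_trans (lerD (fM _) (gN _)))//.
rewrite -mulrDl (le_trans (ler_wpM2r (nr_ge0 _) (lerD (ler_norm M) (ler_norm N))))//.
by rewrite ler_wpM2l ?addr_ge0// -[leRHS]mul1r ltW.
Qed.

(** All bounded extensions of [S] agree with [f] by density, and [f] is one of them. A formula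
    checked on [dom S] thus identifies the extension. *)
Lemma maps_to_bounded_ext X Y (S : operator X Y) (f : X -> Y) (M : R) :
  linear f -> (forall x, nr (f x) <= M * nr x) ->
  (forall x e, 0 < e -> exists2 d, dom S d & nr (x - d) < e) ->
  (forall x y, maps_to S x y -> y = f x) ->
  forall x y, maps_to (bounded_ext S) x y <-> y = f x.
Proof.
move=> f_lin fM S_dense Sf x y.
have ext_unique z w : (exists B : operator X Y,
    [/\ bounded_op B, op_sub S B & B z = w]) -> w = f z.
  move=> [B [/bounded_opP[_ B_lin [N BN]] [_ SB] <-]].
  apply: (linear_eq_on_dense B_lin f_lin BN fM S_dense) => d Sd.
  by rewrite -SB ?mem_set//; apply: Sf.
have f_ext : exists B : operator X Y, [/\ bounded_op B, op_sub S B & B x = f x].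
  exists (Operator setT f); split=> //.
    by apply: (bounded_op_of_fun f_lin fM) => z w; split=> [[]|->].
  by split=> // d /set_mem Sd; apply: Sf.
rewrite maps_to_rel; split=> [[/ext_unique]//|->].
by split=> // y' /ext_unique.
Qed.

End OperatorGraphs.

Section MapsTo.
Context {R : realType}.
Implicit Types X Y Z : hilbertType R.

Lemma maps_to_funct X Y (T : operator X Y) x y y' :
  maps_to T x y -> maps_to T x y' -> y = y'.
Proof. by move=> [_ <-] [_ <-]. Qed.

Lemma maps_to_everywhere X Y (T : operator X Y) (f : X -> Y) :
  (forall x, maps_to T x (f x)) -> forall x y, maps_to T x y <-> y = f x.
Proof.
move=> Tf x y; split=> [xy|->]; last exact: Tf.
exact: maps_to_funct xy (Tf x).
Qed.

Lemma op_eq_total X Y (S T : operator X Y) (f : X -> Y) :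
  (forall x, maps_to S x (f x)) -> (forall x, maps_to T x (f x)) -> S === T.
Proof.
move=> Sf Tf; apply: op_eqP => x y.
by rewrite (maps_to_everywhere Sf) (maps_to_everywhere Tf).
Qed.

Lemma maps_to_inv_fun X Y (T : operator X Y) (f : Y -> X) :
  (forall x y, maps_to T x y <-> x = f y) -> forall y, maps_to (op_inv T) y (f y).
Proof. by move=> Tf y; rewrite maps_to_inv Tf; split=> // x'; rewrite Tf. Qed.

Lemma maps_to_zero X Y x : maps_to (op_zero X Y) x 0.
Proof. by []. Qed.

Lemma maps_to_add X Y (S T : operator X Y) x z :
  maps_to (op_add S T) x z <->
    exists a b, [/\ maps_to S x a, maps_to T x b & z = a + b].
Proof.
split=> [[[Sx Tx] <-]|[a [b [[Sx <-] [Tx <-] ->]]]]; last by split.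
by exists (S x), (T x).
Qed.

Lemma maps_to_block X Y (A : operator X X) (B : operator Y X)
    (C : operator X Y) (D : operator Y Y) (p q : hsum X Y) :
  maps_to (op_block A B C D) p q <-> exists a b c d,
    [/\ maps_to A p.1 a, maps_to B p.2 b, maps_to C p.1 c, maps_to D p.2 d
      & q = (a + b, c + d)].
Proof.
split=> [[[[Ap Bp] [Cp Dp]] <-]|].
  by exists (A p.1), (B p.2), (C p.1), (D p.2).
by move=> [a [b [c [d [[Ap <-] [Bp <-] [Cp <-] [Dp <-] ->]]]]]; split.
Qed.

Lemma inner_eq_rip X Y (a y : X) (b z : Y) :
  rip a y = rip b z -> rip ('i *: a) y = rip ('i *: b) z -> inner a y = inner b z.
Proof.
rewrite !rip_i => re /oppr_inj im; apply/eqP; rewrite eq_complex.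
by apply/andP; split; apply/eqP.
Qed.

Lemma rip_hsum X Y (p q : hsum X Y) : rip p q = rip p.1 q.1 + rip p.2 q.2.
Proof. by rewrite /rip -raddfD. Qed.

Lemma nr_hsum1 X Y (p : hsum X Y) : nr p.1 <= nr p.
Proof. by rewrite -lecR !nrE hsum_norm1. Qed.

Lemma nr_hsum2 X Y (p : hsum X Y) : nr p.2 <= nr p.
Proof. by rewrite -lecR !nrE hsum_norm2. Qed.

Lemma nr_hsum_le X Y (p : hsum X Y) : nr p <= nr p.1 + nr p.2.
Proof. by rewrite -lecR rmorphD/= !nrE hsum_norm_le. Qed.

End MapsTo.

(** * The orthogonal projection as an everywhere defined map *)

Section OrthogonalProjection.
Context {R : realType} {K : hilbertType R}.
Variable G : set K.
Hypotheses (G_sub : lsubspace G) (G_closed : rate_closed G).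

Lemma orthproj_fun : exists P : K -> K, [/\ forall x, G (P x),
  forall x g, G g -> rip (x - P x) g = 0,
  forall x p, G p -> (forall g, G g -> rip (x - p) g = 0) -> P x = p &
  forall x, maps_to (orthproj G) x (P x)].
Proof.
have /choice[P P_spec] : forall x, exists p, G p /\ forall g, G g -> rip (x - p) g = 0.
  by move=> x; have [p Gp xp] := projection_exists G_sub G_closed x; exists p.
have P_unique x p : G p -> (forall g, G g -> rip (x - p) g = 0) -> P x = p.
  move=> Gp xp; apply/eqP; rewrite -subr_eq0; apply/eqP/nr0_eq/eqP.
  have GPp : G (P x - p) by apply: subspaceB => //; exact: (P_spec x).1.
  have : nr (P x - p) ^+ 2 == 0.
    (* [P x - p] is the difference of the residuals [x - p] and [x - P x], and both are orthogonal
       to it. *)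
    rewrite -rip_nr -[X in rip X](subrKA x (P x)) addrC.
    by rewrite -[P x - x]opprB ripBl xp// (P_spec x).2// subrr.
  by rewrite expf_eq0.
exists P; split=> //; [by move=> x; case: (P_spec x)|by move=> x; case: (P_spec x)|].
move=> x; rewrite maps_to_rel; split; last first.
  by move=> p [Gp xp]; rewrite (P_unique x p)// => g Gg; rewrite /rip xp.
split; first exact: (P_spec x).1.
move=> g Gg; have -> : 0 = inner (0 : K) g by rewrite linear0l.
apply: inner_eq_rip.
  by rewrite rip0l (P_spec x).2.
rewrite scaler0 rip0l.
(* The imaginary part of [inner] is reached by testing against ['i *: g], which is again in [G]. *)
by rewrite rip_iC (P_spec x).2 ?oppr0//; exact: subspaceZ.
Qed.

End OrthogonalProjection.

Section ProjectionMap.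
Context {R : realType} {K : hilbertType R}.
Variables (G : set K) (P : K -> K).
Hypotheses (G_sub : lsubspace G) (PG : forall x, G (P x)).
Hypothesis P_orth : forall x g, G g -> rip (x - P x) g = 0.
Hypothesis P_unique :
  forall x p, G p -> (forall g, G g -> rip (x - p) g = 0) -> P x = p.

Lemma projection_linear : linear P.
Proof.
move=> a x y; apply: P_unique => [|g Gg]; first exact: G_sub.2.
have Z z : rip (a *: (z - P z)) g = 0.
  case: a => u v; rewrite [u +i* v]complexE scalerDl ripDl ripZl P_orth// mulr0 add0r.
  rewrite -scalerA rip_iC ripZl P_orth ?mulr0 ?oppr0//.
  exact: subspaceZ.
by rewrite opprD addrACA -scalerBr ripDl Z P_orth// addr0.
Qed.

Lemma projection_sym x y : rip (P x) y = rip x (P y).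
Proof.
have h z w : rip (P z) w = rip (P z) (P w).
  by apply/eqP; rewrite -subr_eq0 -ripBr ripC P_orth.
by rewrite h ripC -h ripC.
Qed.

Lemma projection_idem x : P (P x) = P x.
Proof. by apply: P_unique => // g _; rewrite subrr rip0l. Qed.

Lemma projection_le x : nr (P x) <= nr x.
Proof.
rewrite nr_le_sq ?nr_ge0//; have := sqr_ge0 (nr (x - P x)).
rewrite nr_sqB; have -> : rip x (P x) = nr (P x) ^+ 2.
  by rewrite -rip_nr projection_sym projection_idem.
by lra.
Qed.

End ProjectionMap.

(** * Unitary equivalence of two projections *)

Section RiemannSphere.
Context {R : realType} {H : hilbertType R}.
Local Notation HH := (hsum H H).

Lemma two_projections (K : hilbertType R) (P Q : K -> K) :
  linear P -> linear Q ->
  (forall x y, rip (P x) y = rip x (P y)) -> (forall x y, rip (Q x) y = rip x (Q y)) ->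
  (forall x, P (P x) = P x) -> (forall x, Q (Q x) = Q x) ->
  (forall x, P x + Q x = x -> x = 0) ->
  exists u : K -> K, [/\ linear u, forall x y, rip (u x) y = rip x (u y),
    forall x, u (u x) = x & forall x, P x = u (Q (u x))].
Proof.
move=> P_lin Q_lin P_sym Q_sym PP QQ PQ0.
have le_of (F : K -> K) : (forall x y, rip (F x) y = rip x (F y)) ->
    (forall x, F (F x) = F x) -> forall x, nr (F x) <= 1 * nr x.
  move=> F_sym FF x; rewrite mul1r nr_le_sq ?nr_ge0//.
  have := sqr_ge0 (nr (x - F x)).
  rewrite nr_sqB; have -> : rip x (F x) = nr (F x) ^+ 2 by rewrite -rip_nr F_sym FF.
  by lra.
pose S x := P x + Q x - x.
have S_lin : linear S.
  move=> a x y; rewrite /S P_lin Q_lin scalerBr scalerDr.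
  by rewrite (addrACA (a *: P x)) opprD (addrACA (a *: P x + _)).
have S_sym x y : rip (S x) y = rip x (S y).
  by rewrite /S !ripBl !ripDl !ripBr !ripDr P_sym Q_sym.
have S_le x : nr (S x) <= nr x.
  (* For two projections, [(P + Q - 1)^2 + (P - Q)^2 = 1]. *)
  rewrite nr_le_sq ?nr_ge0//; have := sqr_ge0 (nr (P x - Q x)).
  rewrite /S nr_sqB nr_sqD nr_sqB ripDl !(ripC _ x).
  have -> : rip x (P x) = nr (P x) ^+ 2 by rewrite -rip_nr P_sym PP.
  have -> : rip x (Q x) = nr (Q x) ^+ 2 by rewrite -rip_nr Q_sym QQ.
  by lra.
have S_inj x : S x = 0 -> x = 0 by move=> /eqP; rewrite subr_eq0 => /eqP; exact: PQ0.
have [u [u_lin u_sym uu uC]] := sign_exists S_lin S_sym S_le S_inj.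
exists u; split=> // x; rewrite -{1}[x]uu.
apply: (uC P Q 1 1 P_lin Q_lin (le_of _ P_sym PP) (le_of _ Q_sym QQ)) => y.
- by rewrite /S (linB P_lin) (linD P_lin) PP QQ addrAC subrr add0r addrK.
- by rewrite /S (linB Q_lin) (linD Q_lin) PP QQ addrK addrAC subrr add0r.
Qed.

(** Take for [Q] the projection to the first summand. The symmetric involution [u] with [P = u Q u]
    is its own adjoint, hence unitary. The fourth hypothesis is injectivity of [P + Q - 1]. *)
Lemma riemann_sphereP (T : operator HH HH) (P : HH -> HH) :
  linear P -> (forall x y, rip (P x) y = rip x (P y)) -> (forall x, P (P x) = P x) ->
  (forall x, P x + (x.1, 0) = x -> x = 0) ->
  (forall x, maps_to T x (P x)) -> riemann_sphere H T.
Proof.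
move=> P_lin P_sym PP PQ0 TP; pose Q (x : HH) : HH := (x.1, 0).
have Q_lin : linear Q.
  by move=> a x y; congr pair; rewrite /= scaler0 addr0.
have Q_sym x y : rip (Q x) y = rip x (Q y) by rewrite !rip_hsum /= rip0l rip0r.
have [u [u_lin u_sym uu PuQ]] := two_projections P_lin Q_lin P_sym Q_sym
  PP (fun=> erefl) PQ0.
pose U : operator HH HH := Operator setT u.
have Uu x : maps_to U x (u x) by [].
have U_adj x : maps_to (op_adj U) x (u x).
  have adj z : forall y, dom U y -> inner (U y) z = inner y (u z).
    move=> y _; apply: inner_eq_rip => /=; first exact: u_sym.
    by rewrite -(linZ u_lin) u_sym.
  rewrite maps_to_rel; split; first exact: adj.
  by move=> y' y'x; apply: rip_eq => z; rewrite {1}/rip -y'x// adj.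
exists U; split; last first.
  apply: (op_eq_total TP) => x; rewrite maps_to_mul.
  exists (u x); split; first exact: U_adj.
  rewrite maps_to_mul; exists (Q (u x)); rewrite PuQ; split; last exact: Uu.
  rewrite maps_to_block; exists (u x).1, 0, 0, 0.
  by split; rewrite ?addr0//; exact: maps_to_zero.
split.
- apply: (@bounded_op_of_fun _ _ _ _ u 1) => // [x|x y]; last exact: maps_to_everywhere.
  by rewrite mul1r nr_le_sq ?nr_ge0// -!rip_nr u_sym uu.
- apply: (@op_eq_total _ _ _ _ _ id) => // x; rewrite maps_to_mul.
  by exists (u x); split=> //; rewrite -{2}[x]uu.
- apply: (@op_eq_total _ _ _ _ _ id) => // x; rewrite maps_to_mul.
  by exists (u x); split=> //; rewrite -{2}[x]uu.
Qed.

End RiemannSphere.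

(** * The projection onto a graph *)

Section GraphProjection.
Context {R : realType} {H : hilbertType R}.
Local Notation HH := (hsum H H).
Variables (T : operator H H) (P : HH -> HH).
Hypotheses (T_linear : linear_op T) (T_dense : densely_defined T).
Hypotheses (P_graph : forall p, graph T (P p))
  (P_orth : forall p g, graph T g -> rip (p - P p) g = 0)
  (P_unique : forall p q, graph T q ->
    (forall g, graph T g -> rip (p - q) g = 0) -> P p = q).

(** The relation [T^* k = z] before uniqueness of [z], which density of the domain supplies. *)
Definition is_adjoint (k z : H) := forall h, dom T h -> inner (T h) k = inner h z.

Lemma op0 : T 0 = 0.
Proof.
have [T0 T_lin] := T_linear; have [_] := T_lin 1 0 0 T0 T0.
rewrite !scale1r addr0 => /eqP.
by rewrite -subr_eq0 opprD addrA subrr sub0r oppr_eq0 => /eqP.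
Qed.

Lemma opZ a h : dom T h -> dom T (a *: h) /\ T (a *: h) = a *: T h.
Proof.
by move=> Th; have := T_linear.2 a h 0 Th T_linear.1; rewrite op0 !addr0.
Qed.

Lemma graph_subspace : lsubspace (graph T).
Proof.
split; first by exists 0; [exact: T_linear.1|rewrite op0].
move=> a _ _ [h Th <-] [k Tk <-]; have [Thk hk] := T_linear.2 a h k Th Tk.
by exists (a *: h + k) => //; rewrite hk.
Qed.

Lemma is_adjointP k z :
  is_adjoint k z <-> forall h, dom T h -> rip (T h) k = rip h z.
Proof.
split=> [kz h Th|kz h Th]; first by rewrite /rip kz.
apply: inner_eq_rip; first exact: kz.
by have [aTh <-] := opZ 'i Th; exact: kz.
Qed.

Lemma is_adjointN k z : is_adjoint k z -> is_adjoint (- k) (- z).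
Proof. by move=> kz h Th; rewrite !linearNr/= kz. Qed.

Lemma is_adjoint_unique k z z' : is_adjoint k z -> is_adjoint k z' -> z = z'.
Proof.
move=> /is_adjointP kz /is_adjointP kz'.
apply/eqP; rewrite -subr_eq0; apply/eqP.
apply: (eq0_of_dense (dense_nr T_dense)) => h Th.
by rewrite ripBr -kz// -kz'// subrr.
Qed.

Lemma is_adjoint_orth (a b : H) :
  (forall g, graph T g -> rip ((a, b) : HH) g = 0) <-> is_adjoint b (- a).
Proof.
rewrite is_adjointP; split=> [ab h Th|ab _ [h Th <-]].
  have := ab (h, T h) (ex_intro2 _ _ h Th erefl); rewrite rip_hsum/= ripNr.
  by rewrite (ripC a) (ripC b) => /eqP; rewrite addrC addr_eq0 => /eqP.
by rewrite rip_hsum /= (ripC a) (ripC b) ab// ripNr subrr.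
Qed.

Lemma maps_to_adj k z : maps_to (op_adj T) k z <-> is_adjoint k z.
Proof.
rewrite maps_to_rel; split=> [[]//|kz]; split=> // z' kz'.
exact: is_adjoint_unique kz' kz.
Qed.

(** The residual [p - P p] is orthogonal to the graph, so it has the form [(- T^* k, k)] with
    [k = p.2 - T h]. *)
Lemma graph_proj_ex p :
  exists h, [/\ dom T h, is_adjoint (p.2 - T h) (h - p.1) & P p = (h, T h)].
Proof.
have [h Th hp] := P_graph p; exists h; split=> //.
rewrite -[h - _]opprB; apply/is_adjoint_orth => g Gg.
by have := P_orth p Gg; rewrite -hp.
Qed.

Lemma graph_proj_eq p h : dom T h -> is_adjoint (p.2 - T h) (h - p.1) ->
  P p = (h, T h).
Proof.
move=> Th hp; apply: P_unique; first by exists h.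
by apply/is_adjoint_orth; rewrite opprB.
Qed.

Let P_lin : linear P := projection_linear graph_subspace P_graph P_orth P_unique.

Lemma graph_proj_split x y : P (x, y) = P (x, 0) + P (0, y).
Proof. by rewrite -(linD P_lin); congr (P (_, _)); rewrite /= ?addr0 ?add0r. Qed.

(** The vector [(T^* y, - y)] is orthogonal to the graph, so [P] kills it. *)
Lemma graph_proj_adj y z : is_adjoint y z -> P (z, 0) = P (0, y).
Proof.
move=> yz; have : P (z, - y) = 0.
  rewrite (@graph_proj_eq _ 0) ?op0//; first exact: T_linear.1.
  by rewrite subr0 sub0r; exact: is_adjointN.
rewrite graph_proj_split => /eqP; rewrite addr_eq0 -(linN P_lin) => /eqP ->.
by congr (P (_, _)); rewrite /= ?oppr0 ?opprK.
Qed.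

(** Let [y] be orthogonal to the domain of [T^*] and [P (0, y) = (h, T h)]. Then [y - T h] is in
    that domain, so the residual of [(0, y)] has squared norm [rip (y - T h) y = 0]. Hence [(0, y)]
    is in the graph and [y = T 0 = 0]. *)
Lemma adjoint_dense (x : H) (e : R) : 0 < e ->
  exists2 k, dom (op_adj T) k & nr (x - k) < e.
Proof.
apply: dense_of_orthogonal.
  split; first by apply: ((maps_to_adj 0 0).2 _).1 => h _; rewrite !linear0r.
  move=> a k k' Dk Dk'.
  have kz := (maps_to_adj _ _).1 (conj Dk erefl).
  have kz' := (maps_to_adj _ _).1 (conj Dk' erefl).
  apply: ((maps_to_adj _ (a *: op_adj T k + op_adj T k')).2 _).1 => h Th.
  by rewrite !linearPr/= kz// kz'.
move=> y Dy; have [h [Th hy Ph]] := graph_proj_ex (0, y).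
have P0y : P (0, y) = (0, y).
  apply/eqP; rewrite eq_sym -subr_eq0; apply/eqP/nr0_eq/eqP.
  suff : nr (((0, y) : HH) - P (0, y)) ^+ 2 == 0 by rewrite expf_eq0.
  rewrite -rip_nr [X in rip _ X]/(_ - _) ripBr (P_orth _ (P_graph (0, y))) subr0.
  rewrite Ph rip_hsum /= rip0r add0r Dy//.
  by have [] := (maps_to_adj _ _).2 hy.
by move: Ph; rewrite P0y => -[<- ->]; exact: op0.
Qed.

(** [x = h + T^* T h] says that [(x, 0) - (h, T h)] is orthogonal to the graph. The equivalence
    holds for every [x], so it gives both bijectivity and the inverse. *)
Lemma maps_to_1TT h x :
  maps_to (op_add (op_id H) (op_mul (op_adj T) T)) h x <-> h = (P (x, 0)).1.
Proof.
split=> [|->].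
  rewrite maps_to_add => -[_ [z [[_ <-]]]].
  rewrite maps_to_mul => -[_ [[Th <-] /maps_to_adj hz]] ->.
  rewrite (@graph_proj_eq _ h)//= sub0r opprD addrA subrr sub0r.
  exact: is_adjointN.
have [h' [Th hx ->]] := graph_proj_ex (x, 0); rewrite maps_to_add/=.
exists h', (x - h'); split=> //; last by rewrite addrC subrK.
rewrite maps_to_mul; exists (T h'); split=> //; apply/maps_to_adj.
by rewrite -[T h']opprK -[x - h']opprB; apply: is_adjointN; rewrite -sub0r.
Qed.

(** Here [k] is the second coordinate of the residual of [(0, y)], and
    [P (0, y) = (T^* k, T T^* k)]. *)
Lemma maps_to_1TTadj k y :
  maps_to (op_add (op_id H) (op_mul T (op_adj T))) k y <-> k = y - (P (0, y)).2.
Proof.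
split=> [|->].
  rewrite maps_to_add => -[_ [w [[_ <-]]]].
  rewrite maps_to_mul => -[z [/maps_to_adj kz [Tz <-]]] ->.
  by rewrite (@graph_proj_eq _ z)//= ?addrK// subr0.
have [z [Tz hz ->]] := graph_proj_ex (0, y); rewrite maps_to_add/=.
exists (y - T z), (T z); split=> //; last by rewrite subrK.
rewrite maps_to_mul; exists z; split=> //; apply/maps_to_adj.
by move: hz; rewrite /= subr0.
Qed.

Local Notation A := (op_inv (op_add (op_id H) (op_mul (op_adj T) T))).

Lemma maps_to_A x : maps_to A x (P (x, 0)).1.
Proof. exact: (maps_to_inv_fun maps_to_1TT). Qed.

Lemma maps_to_TA x : maps_to (op_mul T A) x (P (x, 0)).2.
Proof.
rewrite maps_to_mul; exists (P (x, 0)).1; split; first exact: maps_to_A.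
by have [h [Th _ ->]] := graph_proj_ex (x, 0).
Qed.

Lemma maps_to_ATadj y x : maps_to (op_mul A (op_adj T)) y x -> x = (P (0, y)).1.
Proof.
rewrite maps_to_mul => -[z [/maps_to_adj /graph_proj_adj <- /maps_to_funct]].
by apply; exact: maps_to_A.
Qed.

Lemma maps_to_TATadj y x :
  maps_to (op_mul (op_mul T A) (op_adj T)) y x -> x = (P (0, y)).2.
Proof.
rewrite maps_to_mul => -[z [/maps_to_adj /graph_proj_adj <- /maps_to_funct]].
by apply; exact: maps_to_TA.
Qed.

(** The row sends [(x, y)] to [x + T^* y], and [P (x + T^* y, 0) = P (x, 0) + P (0, y)]. *)
Lemma maps_to_colrow p q :
  maps_to (op_mul (op_mul (op_col (op_id H) T) A) (op_row (op_id H) (op_adj T))) p q ->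
  q = P p.
Proof.
rewrite maps_to_mul => -[w [[[_ Dp] <-]]].
have /maps_to_adj pz := conj Dp (erefl (op_adj T p.2)).
rewrite maps_to_mul => -[h [/maps_to_funct/(_ (maps_to_A _)) -> [_ <-]]].
case: p Dp pz => x y /= _ /graph_proj_adj yz.
rewrite (graph_proj_split x y) -yz -(linD P_lin).
have -> : (x, 0) + (op_adj T y, 0) = (x + op_adj T y, 0) :> HH.
  by congr pair; rewrite /= addr0.
by have [h' [_ _ ->]] := graph_proj_ex (x + op_adj T y, 0).
Qed.

(** The inverse of the diagonal sends [(x, y)] to [(h, k)] with [P (x, 0) = (h, T h)] and
    [P (0, y) = (T^* k, T T^* k)]; the left block adds these two vectors. *)
Lemma maps_to_block_inv p : maps_to
  (op_mul (op_block (op_id H) (op_adj T) T (op_mul T (op_adj T)))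
     (op_inv (op_block (op_add (op_id H) (op_mul (op_adj T) T)) (op_zero H H)
        (op_zero H H) (op_add (op_id H) (op_mul T (op_adj T)))))) p (P p).
Proof.
rewrite maps_to_mul; exists ((P (p.1, 0)).1, p.2 - (P (0, p.2)).2); split.
  pose f (q : HH) : HH := ((P (q.1, 0)).1, q.2 - (P (0, q.2)).2).
  apply: (@maps_to_inv_fun _ _ _ _ f) => -[x y] [x' y'].
  rewrite maps_to_block; split=> /=.
    move=> [a [b [c [d [+ [_ <-] [_ <-] + [-> ->]]]]]].
    by rewrite addr0 add0r maps_to_1TT maps_to_1TTadj => -> ->.
  move=> [/maps_to_1TT xx /maps_to_1TTadj yy].
  by exists x', 0, 0, y'; split=> //; rewrite addr0 add0r.
case: p => x y; rewrite graph_proj_split /=.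
have [h [Th hx ->]] := graph_proj_ex (x, 0).
have [z [Tz hz ->]] := graph_proj_ex (0, y).
have {}hz : maps_to (op_adj T) (y - T z) z.
  by apply/maps_to_adj; move: hz; rewrite /= subr0.
rewrite maps_to_block; exists h, z, (T h), (T z); split=> //=.
by rewrite maps_to_mul; exists z.
Qed.

End GraphProjection.

(* Identification of all the formulas with the projection onto the graph *)
Local Close Scope complex_scope.

Theorem proposition5p2 (R : realType) (H : hilbertType R) (T : operator H H)
    (T_linear : linear_op T) (T_dense : densely_defined T)
    (T_closed : closed_graph T) :
  [/\ riemann_sphere H (orthproj (graph T)),
      orthproj (graph T) ===
        bounded_ext (op_col 1 T * (1 + T^* * T)^-1 * op_row 1 (T^*))%op,
      orthproj (graph T) ===
        (op_block 1 (T^*) T (T * T^*)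
         * (op_block (1 + T^* * T) 0 0 (1 + T * T^*))^-1)%op,
      orthproj (graph T) ===
        op_block ((1 + T^* * T)^-1)
                 (bounded_ext ((1 + T^* * T)^-1 * T^*))
                 (T * (1 + T^* * T)^-1)
                 (bounded_ext (T * (1 + T^* * T)^-1 * T^*)) &
      [/\ bounded_op ((1 + T^* * T)^-1),
          bounded_op (bounded_ext ((1 + T^* * T)^-1 * T^*)),
          bounded_op (T * (1 + T^* * T)^-1) &
          bounded_op (bounded_ext (T * (1 + T^* * T)^-1 * T^*))]].
Proof.
have G_sub := graph_subspace T_linear.
have G_closed := closed_rate_closed T_closed.
have [P [PG P_orth P_unique projP]] := orthproj_fun G_sub G_closed.
have P_lin := projection_linear G_sub PG P_orth P_unique.
have P_le := projection_le PG P_orth P_unique.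
(* Between the inclusions and the coordinates, [P] gives four corner maps, all contractions; they
   are the matrix entries. *)
pose in1 (x : H) : hsum H H := (x, 0); pose in2 (y : H) : hsum H H := (0, y).
have in1_lin : linear in1 by move=> a x y; congr pair; rewrite /= scaler0 addr0.
have in2_lin : linear in2 by move=> a x y; congr pair; rewrite /= scaler0 addr0.
have in1_le x : nr (in1 x) <= nr x by rewrite (le_trans (nr_hsum_le _))//= nr0 addr0.
have in2_le x : nr (in2 x) <= nr x by rewrite (le_trans (nr_hsum_le _))//= nr0 add0r.
have p11_lin : linear (fun x => (P (in1 x)).1) by move=> a x y; rewrite in1_lin P_lin.
have p12_lin : linear (fun x => (P (in2 x)).1) by move=> a x y; rewrite in2_lin P_lin.
have p21_lin : linear (fun x => (P (in1 x)).2) by move=> a x y; rewrite in1_lin P_lin.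
have p22_lin : linear (fun x => (P (in2 x)).2) by move=> a x y; rewrite in2_lin P_lin.
have p11_le x : nr (P (in1 x)).1 <= 1 * nr x.
  by rewrite mul1r (le_trans (nr_hsum1 _))// (le_trans (P_le _)).
have p12_le x : nr (P (in2 x)).1 <= 1 * nr x.
  by rewrite mul1r (le_trans (nr_hsum1 _))// (le_trans (P_le _)).
have p21_le x : nr (P (in1 x)).2 <= 1 * nr x.
  by rewrite mul1r (le_trans (nr_hsum2 _))// (le_trans (P_le _)).
have p22_le x : nr (P (in2 x)).2 <= 1 * nr x.
  by rewrite mul1r (le_trans (nr_hsum2 _))// (le_trans (P_le _)).
have Tadj_dense := adjoint_dense T_linear T_dense PG P_orth.
have E11 := maps_to_A T_linear T_dense PG P_orth P_unique.
have E21 := maps_to_TA T_linear T_dense PG P_orth P_unique.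
have E12 : forall y x,
    maps_to (bounded_ext ((1 + T^* * T)^-1 * T^*)) y x <-> x = (P (in2 y)).1.
  apply: (maps_to_bounded_ext p12_lin p12_le).
    (* Since [(1 + T^* T)^-1] is defined everywhere, the product is defined on the whole domain of
       [T^*]. *)
    move=> x e /(Tadj_dense x)[k Dk xk]; exists k => //.
    by split=> //; case: (E11 (op_adj T k)).
  exact: maps_to_ATadj T_linear T_dense PG P_orth P_unique.
have E22 : forall y x,
    maps_to (bounded_ext (T * (1 + T^* * T)^-1 * T^*)) y x <-> x = (P (in2 y)).2.
  apply: (maps_to_bounded_ext p22_lin p22_le).
    move=> x e /(Tadj_dense x)[k Dk xk]; exists k => //.
    by split=> //; case: (E21 (op_adj T k)).
  exact: maps_to_TATadj T_linear T_dense PG P_orth P_unique.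
split.
- apply: (riemann_sphereP P_lin _ _ _ projP).
  + exact: projection_sym PG P_orth.
  + exact: projection_idem PG P_unique.
  (* Comparing coordinates gives [h = 0] and [y = T h = 0]. The residual condition becomes
     [T^* 0 = - x], so [x = 0]. *)
  + move=> [x y]; have [h [Th hx ->]] := graph_proj_ex T_linear PG P_orth (x, y).
    move=> [/= /eqP]; rewrite -[X in _ == X]add0r (inj_eq (addIr x)) => /eqP h0.
    rewrite addr0 => Ty; move: hx; rewrite /= Ty subrr h0 sub0r => hx.
    rewrite -Ty h0 (op0 T_linear).
    suff -> : x = 0 by [].
    apply: oppr_inj; rewrite oppr0; apply: (is_adjoint_unique T_linear T_dense hx).
    by move=> k _; rewrite !linear0r.
- apply: (op_eq_total projP) => p.
  apply/(@maps_to_bounded_ext _ _ _ _ P 1) => //.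
  + by move=> q; rewrite mul1r.
  (* The product is defined at every [(x, k)] with [k] in the domain of [T^*], so only the second
     coordinate is moved. *)
  + move=> [x y] e /(Tadj_dense y)[k Dk yk]; exists (x, k).
      split; first by split.
      split; first by case: (E11 (x + op_adj T k)).
      by split=> //; case: (E21 (x + op_adj T k)) => -[].
    by rewrite (le_lt_trans (nr_hsum_le _))//= subrr nr0 add0r//.
  + exact: maps_to_colrow T_linear T_dense PG P_orth P_unique.
- apply: (op_eq_total projP).
  exact: maps_to_block_inv T_linear T_dense PG P_orth P_unique.
- apply: (op_eq_total projP) => -[x y].
  rewrite maps_to_block (graph_proj_split T_linear PG P_orth P_unique).
  by do 4 eexists; split; [exact: E11|apply/E12|exact: E21|apply/E22|].
- split.
  + exact: bounded_op_of_fun p11_lin p11_le (maps_to_everywhere E11).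
  + exact: bounded_op_of_fun p12_lin p12_le E12.
  + exact: bounded_op_of_fun p21_lin p21_le (maps_to_everywhere E21).
  + exact: bounded_op_of_fun p22_lin p22_le E22.
Qed.
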